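(* Let $q$ be an odd prime power and $d\ge 2$ an integer. Let $t$ be an integer with $0 < t < q$, and let $R \subseteq \mathbb{F}_q^*$ with $|R|=t$. If $S \subseteq \mathbb{F}_q^d$, then $S$ contains every $R$-distance path $\mathcal{P}$ on at most $|S|-4t^{1/2}q^{(d+1)/2}$ vertices.
   Context: For $x=(x_1,\ldots,x_d)\in\mathbb{F}_q^d$, define $\|x\| = x_1^2+\cdots+x_d^2\in\mathbb{F}_q$. $\mathbb{F}_q^*=\mathbb{F}_q\setminus\{0\}$. An $R$-distance path $\mathcal{P}$ is a path $P$ together with a function $f:E(P)\to R$. A set $S\subseteq\mathbb{F}_q^d$ contains $\mathcal{P}$ if there is an injective map $\phi:V(P)\to S$ such that $\|\phi(u)-\phi(v)\|=f(uv)$ for each edge $uv\in E(P)$. *)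

(* Defs.v *)
From HB Require Import structures.
From mathcomp Require Import all_boot all_order all_algebra.
From mathcomp Require Import reals exp.

Set Implicit Arguments.
Unset Strict Implicit.
Unset Printing Implicit Defensive.

Import GRing.Theory Num.Theory.
Local Open Scope ring_scope.

(* No square root is taken: the value lies in F. *)
Definition sqnorm (F : finFieldType) (d : nat) (x : 'rV[F]_d) : F :=
  \sum_(i < d) x ord0 i ^+ 2.

(* A simple graph is given by its edge set, a set of unordered pairs. It is a
   path when s lists all its vertices once and its edges are exactly the pairs
   of consecutive entries of s; a path has at least one vertex. *)
Definition is_path (V : finType) (E : {set {set V}}) : Prop :=
  exists s : seq V,
    [/\ s != [::], uniq s, forall v : V, v \in s
      & E = [set [set e.1; e.2] | e in zip s (behead s)]].

Record dist_path (F : finFieldType) (R : {set F}) := DistPath {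
  dp_vertex : finType;
  dp_edges : {set {set dp_vertex}};
  dp_is_path : is_path dp_edges;
  dp_dist : {e : {set dp_vertex} | e \in dp_edges} -> {r : F | r \in R}
}.

Definition contains_dist_path (F : finFieldType) (d : nat)
    (S : {set 'rV[F]_d}) (R : {set F}) (P : dist_path R) : Prop :=
  exists phi : dp_vertex P -> 'rV[F]_d,
    [/\ injective phi, forall v, phi v \in S
      & forall (u v : dp_vertex P) (uv : [set u; v] \in dp_edges P),
          sqnorm (phi u - phi v) = sval (dp_dist (exist _ [set u; v] uv))].

(* Main.v *)
Require Import Defs.
From HB Require Import structures.
From mathcomp Require Import all_boot all_order all_algebra all_fingroup all_solvable.
From mathcomp Require Import all_field all_character zify ring lra.
From mathcomp Require Import reals exp.

Set Implicit Arguments.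
Unset Strict Implicit.
Unset Printing Implicit Defensive.

Import Order.TTheory GRing.Theory Num.Theory.
Local Open Scope ring_scope.

(** Call a pair of sets D, U of points an r-hole when no point of D is at distance
    r from a point of U. The theorem combines two facts.

    First, for r nonzero an r-hole satisfies #|D| * #|U| <= 4 * q ^ d.+1
    (sphere_hole_bound). By Fourier analysis on the vector space this reduces to
    the bound 4 q on the squared modulus of the sums over nonzero s of
    quad_char s ^+ d * psi (a s + b / s), with quad_char the quadratic character
    and psi a nontrivial additive character. For odd d these are Salie sums, which can be
    evaluated explicitly (salie_bound). For even d they are Kloosterman sums,
    and the estimate is Weil's bound (weil_kloosterman).

    Second, a depth-first search looks for the path: it extends the current path
    by an unvisited vertex at the prescribed distance, and abandons the last
    vertex when this is impossible. When the number k of abandoned vertices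
    equals the number of unvisited ones, sorting the abandoned vertices by the
    distance they were lacking produces at most t holes, whence
    k ^ 2 <= 4 t q ^ d.+1, and the current path has #|S| - 2 k vertices
    (coloured_path_of_holes). This is the length required.

    Weil's bound is proved without zeta functions of curves. For the quadratic
    extension E of F, comparing sums and products of pairs in F with traces and
    norms from E gives K_E = 2 q - K_F ^ 2 (kloosterman_quadratic). Iterated along
    the tower of extensions of degree 2 ^ k, this recursion makes the sums very
    negative if K_F ^ 2 > 4 q. On the other hand the sums over all additive
    characters count the x for which x + b / x has trace zero, and Stepanov's
    polynomial method (trace_fiber_bound) shows that this number is close enough
    to its expected value to exclude such behaviour. *)

(** * Trace fibres of x + b / x by the polynomial method *)

Lemma exprDn_sum (E : comNzRingType) (I : finType) (G : I -> E) (N : nat) :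
  [pchar E]%R.-nat N -> (\sum_i G i) ^+ N = \sum_i G i ^+ N.
Proof.
move=> hN; apply: (big_morph (fun x => x ^+ N)) => [x y|].
  exact: exprDn_pchar.
by rewrite expr0n; case: N hN.
Qed.

Lemma pchar_nat_card (E : finFieldType) : [pchar E]%R.-nat #|E|.
Proof.
have [p p_pr pE] := finPcharP E.
have := abelem_pgroup (fin_ring_pchar_abelem pE).
by rewrite /pgroup cardsT; apply: sub_in_pnat => s _ /eqP->.
Qed.

Lemma card_neq0 (R : finFieldType) : #|[pred x : R | x != 0]| = #|R|.-1.
Proof. by rewrite -(cardC1 (0 : R)); apply: eq_card => x; rewrite !inE. Qed.

Lemma poly_dependence (E : fieldType) (n s : nat) (u : 'I_n -> {poly E}) :
  (forall t, size (u t) <= s)%N -> (s < n)%N ->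
  exists2 a : 'I_n -> E, exists t, a t != 0 & \sum_t a t *: u t = 0.
Proof.
move=> su ltsn.
pose M : 'M[E]_(n, s) := \matrix_(t, i) (u t)`_i.
have : kermx M != 0.
  rewrite kermx_eq0 /row_free; apply: contraTneq (rank_leq_col M) => ->.
  by rewrite -ltnNge.
case/rowV0Pn => v /sub_kermxP vM /rV0Pn[t vt].
exists (v 0); first by exists t.
apply/polyP => i; rewrite coef0 coef_sum.
case: (ltnP i s) => [lis | lsi].
  have /matrixP/(_ 0 (Ordinal lis)) := vM; rewrite !mxE => vM_i.
  apply: etrans vM_i.
  by apply: eq_bigr => k _; rewrite coefZ mxE.
by rewrite big1 // => k _; rewrite coefZ nth_default ?mulr0 // (leq_trans (su k)).
Qed.

(** Distinct degrees prevent the leading terms from cancelling. *)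
Lemma staircase_comb_neq0 (E : idomainType) (n e : nat) (w : 'I_n -> {poly E})
    (a : 'I_n -> E) (t0 : 'I_n) :
  (forall t, size (w t) = (t + e).+1) -> a t0 != 0 ->
  \sum_t a t *: w t != 0.
Proof.
move=> sw at0; pose P t := a t != 0.
case: (@arg_maxnP _ t0 P (fun t => t : nat) at0) => t Pt maxt.
apply/eqP => /polyP/(_ (t + e)%N); rewrite coef0 coef_sum (bigD1 t) //= big1.
  apply/eqP; rewrite addr0 coefZ mulf_neq0 //.
  have -> : (w t)`_(t + e) = lead_coef (w t) by rewrite lead_coefE sw.
  by rewrite lead_coef_eq0 -size_poly_eq0 sw.
move=> k kt; rewrite coefZ; have [->|ak] := eqVneq (a k) 0; first by rewrite mul0r.
rewrite nth_default ?mulr0 // sw.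
have := maxt k ak; have : (k != t :> nat) by [].
lia.
Qed.

(** The expected size of the fibre is #|E| / q = q ^ m * q ^ m.+1, and the error
    is of the order of the square root of #|E|. This is Stepanov's method in
    Bombieri's form, where vanishing to high order comes from taking an r-th
    power instead of from derivatives.  Put rho = q ^ m, r = q ^ m.+1 and
    g(x) = \sum_(l < m.+1) (x + b / x) ^+ (q ^ l), so that the trace equals
    g + g ^+ r.  Consider
      W = \sum a_ijk x^(i + k r) g^j,  0 <= i < rho, 0 <= j < q, 0 <= k < rho + 2.
    Since g has degree rho at infinity, these monomials have the distinct
    degrees i + j rho + k r, so W is nonzero as soon as one a_ijk is.  On the
    fibre, x^(r * r) = x and g^r = c - g, hence W^r takes the same values as
      \sum a_ijk^r x^(i r + k) (c - g)^j,
    whose monomials span a space of smaller dimension.  A linear dependence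
    between them yields a nonzero W that vanishes on the whole fibre, whose size
    is then at most the degree of W.  Multiplication by powers of x turns all
    of these Laurent polynomials into polynomials. *)
Lemma trace_fiber_bound (E : finFieldType) (q m : nat) (b c : E) :
    (2 < q)%N -> (0 < m)%N -> #|E| = (q ^ m.+1 * q ^ m.+1)%N ->
  (#|[set x : E | (x != 0)%R &&
       (\sum_(i < m.+1 + m.+1) (x + b / x) ^+ (q ^ i) == c)%R]|
     <= (q ^ m + 3) * q ^ m.+1)%N.
Proof.
move=> q_gt2 m_gt0 oE.
set rho := (q ^ m)%N; set r := (q ^ m.+1)%N; set B := (rho + 2)%N.
have rE : r = (q * rho)%N by rewrite /r expnS.
have rho_gt2 : (2 < rho)%N by rewrite (leq_trans q_gt2) // -{1}(expn1 q) leq_exp2l // ltnW.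
have q_gt0 : (0 < q)%N by lia.
have r_frob : [pchar E]%R.-nat r.
  by apply: pnat_dvd (pchar_nat_card E); rewrite oE dvdn_mulr.
have rr (x : E) : (x ^+ r) ^+ r = x by rewrite -exprM -oE expf_card.
(* h is X ^ rho * g, a polynomial because the pole of g at 0 has order at most rho *)
pose h : {poly E} :=
  \sum_(l < m.+1) ('X^(rho + q ^ l) + (b ^+ (q ^ l)) *: 'X^(rho - q ^ l)).
pose g (x : E) := \sum_(l < m.+1) (x + b / x) ^+ (q ^ l).
have qfrob l : (l <= m)%N -> [pchar E]%R.-nat (q ^ l)%N.
  by move=> lm; apply: pnat_dvd r_frob; apply: dvdn_exp2l; lia.
have h_eval x : x != 0 -> h.[x] = x ^+ rho * g x.
  move=> x0; rewrite horner_sum mulr_sumr; apply: eq_bigr => l _.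
  have lm : (l <= m)%N by rewrite -ltnS.
  rewrite !hornerE exprDn_pchar ?qfrob // mulrDr exprD expr_div_n.
  congr (_ + _); rewrite mulrCA; congr (_ * _).
  apply: (mulIf (expf_neq0 (q ^ l) x0)).
  by rewrite -exprD subnK ?leq_exp2l ?mulfVK ?expf_neq0 // ltnW // ltnW.
have [h_monic h_size] : h \is monic /\ size h = (2 * rho).+1.
  have hE : exists2 h' : {poly E}, h = 'X^(2 * rho) + h' & (size h' <= 2 * rho)%N.
    rewrite /h big_ord_recr /= -/rho addnn -mul2n subnn.
    eexists; first by rewrite addrCA.
    apply: (leq_trans (size_polyD _ _)); rewrite geq_max; apply/andP; split.
      apply: (leq_trans (size_sum _ _ _)); apply/bigmax_leqP => l _.
      have : (q ^ l < rho)%N by rewrite ltn_exp2l // ltnW.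
      move=> ltl; apply: (leq_trans (size_polyD _ _)).
      rewrite geq_max size_polyXn; apply/andP; split; first by lia.
      by apply: (leq_trans (size_scale_leq _ _)); rewrite size_polyXn; lia.
    by apply: (leq_trans (size_scale_leq _ _)); rewrite size_polyXn; lia.
  case: hE => h' -> sh'.
  have sh2 : (size h' < size ('X^(2 * rho) : {poly E}))%N by rewrite size_polyXn.
  by rewrite monicE lead_coefDl // lead_coefXn size_polyDl // size_polyXn.
(* the monomials are indexed by t = i + j rho + k r, the mixed-radix expansion *)
pose ci (t : nat) := (t %% rho)%N.
pose cj (t : nat) := ((t %/ rho) %% q)%N.
pose ck (t : nat) := (t %/ r)%N.
have tE t : t = (ci t + cj t * rho + ck t * r)%N.
  rewrite {1}(divn_eq t rho) {1}(divn_eq (t %/ rho)%N q) -divnMA mulnC.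
  by rewrite /ci /cj /ck rE (mulnC rho q); nia.
have ci_lt t : (ci t < rho)%N by rewrite ltn_mod; lia.
have cj_lt t : (cj t < q)%N by rewrite ltn_mod.
have ck_lt (t : 'I_(r * B)) : (ck t < B)%N.
  by rewrite /ck ltn_divLR ?expn_gt0 ?q_gt0 // (mulnC B) ltn_ord.
pose w (t : 'I_(r * B)) : {poly E} :=
  'X^(ci t + ck t * r) * h ^+ cj t * 'X^((q.-1 - cj t) * rho).
pose u (t : 'I_(r * B)) : {poly E} :=
  'X^(ci t * r + ck t) * (c *: 'X^rho - h) ^+ cj t * 'X^((q.-1 - cj t) * rho).
have w_size t : size (w t) = (t + q.-1 * rho).+1.
  have sj : size (h ^+ cj t) = (2 * rho * cj t).+1.
    have := size_exp h (cj t); rewrite h_size /= => <-.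
    by rewrite prednK // size_poly_gt0 monic_neq0 // monic_exp.
  rewrite /w size_Mmonic ?monicXn // ?mulf_neq0 ?monic_neq0 ?monicXn ?monic_exp //.
  rewrite size_Mmonic ?monic_exp ?monic_neq0 ?monicXn // !size_polyXn sj.
  have cjE : ((q.-1 - cj t) * rho + cj t * rho = q.-1 * rho)%N.
    by rewrite -mulnDl subnK // -ltnS prednK.
  move: (tE t) cjE; move: (q.-1 - cj t)%N (ci t) (cj t) (ck t) => n i j k.
  by clearbody rho r; nia.
have u_size t : (size (u t) <= (rho + 1) * r + B)%N.
  have sj : (size ((c *: 'X^rho - h) ^+ cj t)%R <= (2 * rho * cj t).+1)%N.
    apply: (leq_trans (size_poly_exp_leq _ _)); rewrite ltnS leq_mul2r.
    apply/orP; right.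
    have : (size (c *: 'X^rho - h)%R <= (2 * rho).+1)%N.
      apply: (leq_trans (size_polyD _ _)); rewrite size_polyN h_size geq_max leqnn.
      rewrite andbT; apply: (leq_trans (size_scale_leq _ _)).
      by rewrite size_polyXn; lia.
    by lia.
  apply: (leq_trans (size_polyMleq _ _)); rewrite size_polyXn.
  have := size_polyMleq ('X^(ci t * r + ck t)) ((c *: 'X^rho - h) ^+ cj t).
  rewrite size_polyXn.
  have := ck_lt t; have := cj_lt t; have := ci_lt t; move: sj.
  move: (size _) (size _) => s1 s2; move: (ci t) (cj t) (ck t) => i j k.
  clearbody B r rho; move=> hs1 hi hj hk hs2.
  have h1 : (i * r <= rho * r - r)%N by nia.
  have h2 : (2 * rho * j + (q.-1 - j) * rho <= 2 * r - 2 * rho)%N by nia.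
  have h3 : (r <= rho * r)%N by nia.
  by lia.
(* there are r B monomials u t; B = rho + 2 makes this exceed the dimension *)
have ltBr : ((rho + 1) * r + B < r * B)%N by rewrite /B; nia.
have [al [t0 al0] al_u] := poly_dependence u_size ltBr.
(* x |-> x ^+ r is an involution of E, so the r-th root of al t is al t ^+ r *)
pose W := \sum_t (al t ^+ r) *: w t.
have W0 : W != 0 by apply: (staircase_comb_neq0 (t0 := t0) w_size); rewrite expf_neq0.
have W_size : (size W <= r * B + r)%N.
  apply: (leq_trans (size_sum _ _ _)); apply/bigmax_leqP => t _.
  apply: (leq_trans (size_scale_leq _ _)); rewrite w_size.
  by have := ltn_ord t; nia.
have W_root x : x != 0 -> \sum_(i < m.+1 + m.+1) (x + b / x) ^+ (q ^ i) = c ->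
    root W x.
  move=> x0 trx.
  have g_tr : g x ^+ r = c - g x.
    rewrite -trx big_split_ord /= -[X in X + _ - _]/(g x) addrAC subrr add0r exprDn_sum //.
    by apply: eq_bigr => l _; rewrite -exprM mulnC -expnD.
  suff: W.[x] ^+ r * x ^+ (q.-1 * rho) = 0.
    move/eqP; rewrite mulf_eq0 !expf_eq0 (negPf x0) andbF orbF.
    by case/andP.
  transitivity ((\sum_t al t *: u t).[x] * x ^+ (q.-1 * rho * r)); last first.
    by rewrite al_u horner0 mul0r.
  rewrite !horner_sum exprDn_sum // !mulr_suml; apply: eq_bigr => t _.
  rewrite /w /u !hornerE h_eval //.
  have -> : c * x ^+ rho - x ^+ rho * g x = x ^+ rho * (c - g x) by ring.
  have gE : (c - g x) ^+ cj t = g x ^+ (cj t * r) by rewrite -g_tr -exprM mulnC.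
  rewrite !exprMn rr gE -!exprM.
  have -> : x ^+ ((ci t + ck t * r) * r) = x ^+ (ci t * r + ck t).
    by rewrite mulnDl !exprD (exprM x (ck t * r)) (exprM x (ck t)) rr.
  have hj s : x ^+ (rho * cj t * s) * x ^+ ((q.-1 - cj t) * rho * s)
      = x ^+ (q.-1 * rho * s).
    rewrite -exprD; congr (_ ^+ _).
    by rewrite -mulnDl (mulnC rho) -mulnDl addnC subnK // -ltnS prednK.
  have := hj 1%N; have := hj r; rewrite !muln1 => <- <- /=.
  by rewrite mulnA; ring.
have := @max_poly_roots _ W
  (enum [set x : E | (x != 0) &&
     (\sum_(i < m.+1 + m.+1) (x + b / x) ^+ (q ^ i) == c)]) W0.
rewrite -cardE enum_uniq => ltW.
have : (#|[set x : E | (x != 0)%R &&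
     (\sum_(i < m.+1 + m.+1) (x + b / x) ^+ (q ^ i) == c)%R]| < size W)%N.
  apply: ltW => //; apply/allP => x; rewrite mem_enum inE => /andP[x0 /eqP].
  exact: W_root.
by move=> /leq_trans/(_ W_size) /ltnW/leq_trans; apply; rewrite /B mulnC; lia.
Qed.

(** * Kloosterman sums in a quadratic extension *)

Record nontriv_addchar (F : finFieldType) (psi : F -> algC) : Prop := {
  addcharD : forall x y, psi (x + y) = psi x * psi y;
  addchar0 : psi 0 = 1;
  addcharN : forall x, psi (- x) = (psi x)^*;
  addchar_neq1 : exists x, psi x != 1
}.

Lemma exists_addchar (F : finFieldType) :
  exists psi : F -> algC, nontriv_addchar psi.
Proof.
have abF : abelian [set: F] by exact: FinRing.zmod_abelian.
have F_gt1 : (1 < Nirr [set: F])%N.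
  by rewrite NirrE (eqP (etrans (esym (card_classes_abelian _)) abF)) cardsT
    finNzRing_gt1.
pose i : Iirr [set: F] := Ordinal F_gt1.
have lin_i : 'chi_i \is a linear_char by apply/char_abelianP.
exists 'chi_i; split=> [x y||x|].
- by rewrite -(lin_charM lin_i) ?inE.
- by rewrite -(lin_char1 lin_i).
- by rewrite -(lin_charV_conj lin_i) ?inE.
case: (pickP [pred x | 'chi_i x != 1]) => [x /= hx|chi1]; first by exists x.
have /irr_inj : 'chi_i = 'chi_0.
  apply/cfunP => x; rewrite irr0 cfun1E inE.
  by apply/eqP; rewrite -[_ == _]negbK; have /= -> := chi1 x.
by move/(congr1 val).
Qed.

Section Addchar.
Variables (F : finFieldType) (psi : F -> algC).
Hypothesis psi_ch : nontriv_addchar psi.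

Lemma addchar_scale (a : F) : a != 0 -> nontriv_addchar (fun x => psi (a * x)).
Proof.
move=> a0; split=> [x y||x|].
- by rewrite mulrDr (addcharD psi_ch).
- by rewrite mulr0 (addchar0 psi_ch).
- by rewrite mulrN (addcharN psi_ch).
have [x hx] := addchar_neq1 psi_ch; exists (a^-1 * x).
by rewrite mulVKf.
Qed.

(** A translation by y multiplies the sum by psi y. *)
Lemma sum_addchar : \sum_x psi x = 0.
Proof.
have [y hy] := addchar_neq1 psi_ch.
have : (psi y - 1) * \sum_x psi x = 0.
  rewrite mulrBl mul1r mulr_sumr.
  rewrite [X in _ - X](reindex_inj (addrI y)) /=.
  by apply/eqP; rewrite subr_eq0; apply/eqP/eq_bigr => x _; rewrite addcharD.
by move/eqP; rewrite mulf_eq0 subr_eq0 (negPf hy) => /eqP.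
Qed.

Lemma sum_addchar_scale (a : F) :
  \sum_x psi (x * a) = #|F|%:R * (a == 0)%:R.
Proof.
have [->|a0] := eqVneq a 0.
  under eq_bigr do rewrite mulr0 addchar0 //.
  by rewrite sumr_const mulr1.
rewrite mulr0 -[RHS](sum_addchar) [RHS](reindex_inj (mulIf a0)) /=.
by [].
Qed.

End Addchar.

Definition kloosterman (F : finFieldType) (psi : F -> algC) (b : F) : algC :=
  \sum_(x | x != 0) psi (x + b / x).

Lemma kloosterman_real (F : finFieldType) (psi : F -> algC) (b : F) :
  nontriv_addchar psi -> kloosterman psi b \is Num.real.
Proof.
move=> psi_ch; apply/CrealP; rewrite /kloosterman rmorph_sum /=.
rewrite (reindex_inj oppr_inj) /=; apply: eq_big => [x|x _].
  by rewrite oppr_eq0.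
by rewrite -addcharN // invrN mulrN -opprD opprK.
Qed.

Lemma two_neq0 (F : finFieldType) : odd #|F| -> (2%:R : F) != 0.
Proof.
move=> oddF; apply/negP => /eqP two0.
have p2 : 2 \in [pchar F]%R by rewrite inE two0 eqxx.
have := pchar_nat_card F; rewrite (eq_pnat _ (pcharf_eq p2)) => /p_natP[[|k] hk].
  by have := finNzRing_gt1 F; rewrite hk.
by move: oddF; rewrite hk expnS oddM.
Qed.

(** Squaring identifies 1 and - 1, so it misses some e, and X ^ 2 - e is then
    irreducible. *)
Lemma quadratic_extension (F : finFieldType) : odd #|F| ->
  exists (E : finFieldType) (iota : {rmorphism F -> E}), #|E| = (#|F| ^ 2)%N.
Proof.
move=> oddF.
have two0 := two_neq0 oddF.
have [e he] : exists e : F, forall x, x ^+ 2 != e.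
  case: (boolP [forall e : F, exists x, x ^+ 2 == e]) => [/forallP sq|].
    have sq' (e : F) : exists x, x ^+ 2 = e.
      by have /existsP[x /eqP] := sq e; exists x.
    have [g gK] := fin_all_exists sq'.
    have gC : cancel g (fun x => x ^+ 2) by [].
    have [g' _ g'K] := injF_bij (can_inj gC).
    have : g' 1 = g' (-1) by rewrite -[LHS]gK -[RHS]gK !g'K sqrrN.
    move/(can_inj g'K)/eqP; rewrite -subr_eq0 opprK -[1 + 1]/(2%:R).
    by rewrite (negPf two0).
  rewrite negb_forall => /existsP[e]; rewrite negb_exists => /forallP he.
  by exists e.
have sp : size ('X^2 - e%:P) = 3.
  by rewrite size_polyDl size_polyXn // size_polyN size_polyC; case: (_ != _).
have irr : irreducible_poly ('X^2 - e%:P).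
  apply: cubic_irreducible; first by rewrite sp.
  by move=> x; rewrite rootE !hornerE subr_eq0.
have [L dimL _] := irredp_FAdjoin irr.
exists (finvect_type L : finFieldType), (GRing.in_alg L).
by rewrite -(@card_vspacef F (finvect_type L) (Vector.class L)) card_vspace dimL sp.
Qed.

Lemma root_cases (R : idomainType) (u v x y : R) :
  u + v = x + y -> u * v = x * y -> u = x \/ u = y.
Proof.
move=> hs hp; have : (u - x) * (u - y) = 0.
  have -> : (u - x) * (u - y) = u ^+ 2 - u * (x + y) + x * y by ring.
  by rewrite -hs -hp; ring.
by move/eqP; rewrite mulf_eq0 !subr_eq0 => /orP[]/eqP->; [left|right].
Qed.

Section QuadExt.
Variables (F E : finFieldType) (iota : {rmorphism F -> E}).
Hypothesis oE : #|E| = (#|F| ^ 2)%N.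
Local Notation q := #|F|.

(** Such y are roots of X ^ q - X, which already splits over F. *)
Lemma frobenius_fixed (y : E) : y ^+ q = y -> exists x, iota x = y.
Proof.
move=> yq; have /(congr1 (map_poly iota)) := finField_genPoly F.
rewrite rmorphB rmorph_prod /= map_polyXn map_polyX.
move/(congr1 (fun p => p.[y])); rewrite !hornerE yq subrr horner_prod.
move/esym/eqP; rewrite prodf_seq_eq0 => /hasP[x _ /=].
rewrite rmorphB /= map_polyX map_polyC !hornerE subr_eq0 => /eqP ->.
by exists x.
Qed.

Lemma frobeniusD (x y : E) : (x + y) ^+ q = x ^+ q + y ^+ q.
Proof.
apply: exprDn_pchar; apply: pnat_dvd (pchar_nat_card E).
by rewrite oE dvdn_exp.
Qed.

Lemma frobenius_invol (x : E) : (x ^+ q) ^+ q = x.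
Proof. by rewrite -exprM mulnn -oE expf_card. Qed.

Lemma exists_trace_norm : exists (tr nm : E -> F),
  (forall x, iota (tr x) = x + x ^+ q) /\ (forall x, iota (nm x) = x * x ^+ q).
Proof.
have htr x : exists t, iota t = x + x ^+ q.
  by apply: frobenius_fixed; rewrite frobeniusD frobenius_invol addrC.
have hnm x : exists t, iota t = x * x ^+ q.
  by apply: frobenius_fixed; rewrite exprMn frobenius_invol mulrC.
have [tr trE] := fin_all_exists htr; have [nm nmE] := fin_all_exists hnm.
by exists tr, nm.
Qed.

Variables (tr nm : E -> F).
Hypothesis trE : forall x, iota (tr x) = x + x ^+ q.
Hypothesis nmE : forall x, iota (nm x) = x * x ^+ q.

Definition fiberE (p : F * F) := [set z : E | (tr z, nm z) == p].
Definition fiberF (p : F * F) :=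
  [set xy : F * F | (xy.1 + xy.2, xy.1 * xy.2) == p].

(** Both fibres consist of roots of X ^ 2 - t X + n for p = (t, n): this
    quadratic either splits over F, or has two conjugate roots in E outside F,
    or has a double root, which is then counted once on each side. *)
Lemma fiber_le2 p : (#|fiberE p| + #|fiberF p| <= 2)%N.
Proof.
have fibE z z' : z \in fiberE p -> z' \in fiberE p -> z' = z \/ z' = z ^+ q.
  rewrite !inE => /eqP <- /eqP[ht hn].
  by apply: (@root_cases _ _ (z' ^+ q)); rewrite -?trE -?nmE ?ht ?hn.
case: (set_0Vmem (fiberF p)) => [->|[[x y]]].
  rewrite cards0 addn0; case: (set_0Vmem (fiberE p)) => [->|[z zp]].
    by rewrite cards0.
  apply: (leq_trans (subset_leq_card (_ : _ \subset [set z; z ^+ q]))).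
    by apply/subsetP => z' z'p; rewrite !inE; case: (fibE _ _ zp z'p) => ->;
      rewrite eqxx ?orbT.
  by rewrite cards2; case: (_ != _).
rewrite inE => /eqP /= hp.
have fibF w : w \in fiberF p -> w = (x, y) \/ w = (y, x).
  rewrite inE -hp => /eqP[hs hm]; case: w hs hm => u v /= hs hm.
  case: (root_cases hs hm) => hu; [left | right]; rewrite hu in hs *.
    by rewrite (addrI _ hs).
  by rewrite addrC in hs; rewrite (addIr _ hs).
have fibEF z : z \in fiberE p -> z = iota x /\ x = y.
  rewrite inE -hp => /eqP[ht hn].
  have zF : z = iota x \/ z = iota y.
    by apply: (@root_cases _ _ (z ^+ q)); rewrite -?rmorphD -?rmorphM -?ht -?hn ?trE ?nmE.
  have zq : z ^+ q = z by case: zF => ->; rewrite -rmorphXn /= expf_card.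
  have hs : z + z = iota x + iota y by rewrite -rmorphD -ht trE zq.
  suff exy : iota x = iota y.
    by split; [case: zF => -> | exact: (fmorph_inj iota)].
  case: zF => hz; rewrite hz in hs; first exact: (addrI _ hs).
  by rewrite (addIr _ hs).
have [exy|nxy] := eqVneq x y.
  apply: (@leq_add _ _ 1 1).
    rewrite -(cards1 (iota x)); apply/subset_leq_card/subsetP => z zp.
    by rewrite inE (fibEF _ zp).1.
  rewrite -(cards1 (x, y)); apply/subset_leq_card/subsetP => w wp.
  by rewrite inE; case: (fibF _ wp) => ->; rewrite exy.
have -> : fiberE p = set0.
  by apply/setP => z; rewrite in_set0; apply/idP => /fibEF[_ /eqP]; rewrite (negPf nxy).
rewrite cards0 add0n.
apply: (leq_trans (subset_leq_card (_ : _ \subset [set (x, y); (y, x)]))).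
  by apply/subsetP => w wp; rewrite !inE; case: (fibF _ wp) => ->; rewrite eqxx ?orbT.
by rewrite cards2; case: (_ != _).
Qed.

Definition nzpairs := [set p : F * F | p.2 != 0].

Lemma tr_nm_nz z : (tr z, nm z) \in nzpairs = (z != 0).
Proof.
by rewrite inE /= -(fmorph_eq0 iota) nmE mulf_eq0 expf_eq0 negb_or;
  case: (z == 0); rewrite ?andbF.
Qed.

(** The fibres have total size q ^ 2 - 1 + (q - 1) ^ 2 = 2 q (q - 1), twice the
    number of pairs, so the upper bound fiber_le2 is attained everywhere. *)
Lemma fiber_eq2 p : p \in nzpairs -> (#|fiberE p| + #|fiberF p| = 2)%N.
Proof.
have tot : (\sum_(p in nzpairs) (#|fiberE p| + #|fiberF p|) = 2 * #|nzpairs|)%N.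
  rewrite big_split /=.
  have -> : (\sum_(p in nzpairs) #|fiberE p| = #|E|.-1)%N.
    rewrite -card_neq0 -sum1_card [RHS](partition_big (fun z => (tr z, nm z)) (mem nzpairs)) /=.
      apply: eq_bigr => p' hp'; rewrite sum1_card; apply: eq_card => z.
      rewrite !inE unfold_in /= andbC; case: eqP => //= e.
      by move: hp'; rewrite -e tr_nm_nz => z0; rewrite ?inE ?z0.
    by move=> z; rewrite inE tr_nm_nz.
  have -> : (\sum_(p in nzpairs) #|fiberF p| = q.-1 * q.-1)%N.
    rewrite -card_neq0 -cardX -sum1_card.
    rewrite [RHS](partition_big (fun z => (z.1 + z.2, z.1 * z.2)) (mem nzpairs)) /=.
      apply: eq_bigr => p' hp'; rewrite sum1_card; apply: eq_card => z.
      rewrite !inE unfold_in /= andbC; case: eqP => //= e.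
      by move: hp'; rewrite -e inE /= mulf_eq0 negb_or => z0; rewrite ?inE ?z0.
    by move=> z; rewrite !inE /= mulf_eq0 negb_or.
  have -> : #|nzpairs| = (q * q.-1)%N.
    by rewrite -card_neq0 -[q]/(#|[pred x : F | true]|) -cardX; apply: eq_card => z; rewrite !inE.
  have := finNzRing_gt1 F; rewrite oE; nia.
move=> hp; apply/eqP; rewrite eqn_leq fiber_le2 leqNgt; apply/negP => lt2.
suff : (\sum_(p in nzpairs) (#|fiberE p| + #|fiberF p|) < \sum_(p in nzpairs) 2)%N.
  by rewrite tot sum_nat_const mulnC ltnn.
rewrite (bigD1 p) //= [X in (_ < X)%N](bigD1 p) //= -addSn leq_add //.
by apply: leq_sum => i _; exact: fiber_le2.
Qed.

Lemma sum_tr_nm (h : F * F -> algC) :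
  \sum_(z : E | z != 0) h (tr z, nm z)
    + \sum_(x | x != 0) \sum_(y | y != 0) h (x + y, x * y)
  = 2%:R * \sum_(p in nzpairs) h p.
Proof.
rewrite (partition_big (fun z => (tr z, nm z)) (mem nzpairs)) /=; last first.
  by move=> z; rewrite tr_nm_nz.
rewrite pair_big /= [X in _ + X](partition_big (fun z => (z.1 + z.2, z.1 * z.2)) (mem nzpairs)) /=;
  last by move=> z; rewrite !inE /= mulf_eq0 negb_or.
rewrite -big_split mulr_sumr /=; apply: eq_bigr => p hp.
rewrite (eq_bigr (fun=> h p)); last by move=> z /andP[_ /eqP ->].
rewrite [X in _ + X](eq_bigr (fun=> h p)); last by move=> z /andP[_ /eqP ->].
rewrite !sumr_const -mulrnDr -[LHS]mulr_natl; congr (_%:R * _).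
rewrite -(fiber_eq2 hp); congr (_ + _)%N; apply: eq_card => z.
  rewrite !inE unfold_in /= andbC; case: eqP => //= e.
  by move: hp; rewrite -e tr_nm_nz => z0; rewrite ?inE ?z0.
rewrite !inE unfold_in /= andbC; case: eqP => //= e.
by move: hp; rewrite -e inE /= mulf_eq0 negb_or => z0; rewrite ?inE ?z0.
Qed.

Lemma trD x y : tr (x + y) = tr x + tr y.
Proof.
by apply: (fmorph_inj iota); rewrite rmorphD !trE frobeniusD addrACA.
Qed.

(** The trace is onto: tr (iota (x / 2)) = x. *)
Lemma addchar_trace (psi : F -> algC) : odd q -> nontriv_addchar psi ->
  nontriv_addchar (psi \o tr).
Proof.
move=> oddq psi_ch.
have tr0 : tr 0 = 0 by apply: (addrI (tr 0)); rewrite -trD !addr0.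
split=> [x y||x|] /=.
- by rewrite trD (addcharD psi_ch).
- by rewrite tr0 (addchar0 psi_ch).
- rewrite -(addcharN psi_ch); congr psi.
  by apply: (addrI (tr x)); rewrite -trD !subrr.
have [x hx] := addchar_neq1 psi_ch; exists (iota (x / 2%:R)).
suff -> : tr (iota (x / 2%:R)) = x by [].
apply: (fmorph_inj iota); rewrite trE -rmorphXn /= expf_card -rmorphD; congr (iota _).
by rewrite -[LHS]mulr2n -[LHS]mulr_natr divfK // two_neq0.
Qed.

(** An elementary form of the relation between the zeta functions over F and E.
    For z in E of trace t and norm n, the trace of z + b / z is t (1 + b / n); for
    x, y in F of sum t and product n, x + b / x + y + b / y is the same quantity.
    By sum_tr_nm the two sides add up to twice
    \sum_(t, n) psi (t (1 + b / n)), where only n = - b survives. *)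
Lemma kloosterman_quadratic (psi : F -> algC) (b : F) :
    nontriv_addchar psi -> b != 0 ->
  kloosterman (psi \o tr) (iota b) = 2%:R * q%:R - kloosterman psi b ^+ 2.
Proof.
move=> psi_ch b0; apply/eqP; rewrite eq_sym subr_eq; apply/eqP.
pose h (p : F * F) := psi (p.1 * (1 + b / p.2)).
have -> : kloosterman (psi \o tr) (iota b) = \sum_(z : E | z != 0) h (tr z, nm z).
  apply: eq_bigr => z z0; rewrite /h /=; congr psi.
  apply: (fmorph_inj iota); rewrite trE !rmorphM rmorphD rmorphM fmorphV rmorph1.
  rewrite trE nmE frobeniusD exprMn exprVn -rmorphXn /= expf_card.
  have zq0 : z ^+ q != 0 by rewrite expf_neq0.
  by field; rewrite zq0.
have -> : kloosterman psi b ^+ 2 =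
    \sum_(x | x != 0) \sum_(y | y != 0) h (x + y, x * y).
  rewrite expr2 mulr_suml; apply: eq_bigr => x x0.
  rewrite mulr_sumr; apply: eq_bigr => y y0; rewrite -(addcharD psi_ch) /h /=.
  by congr psi; field; rewrite x0 y0.
rewrite sum_tr_nm; congr (_ * _); apply: esym.
rewrite (eq_bigl (fun p : F * F => true && (p.2 != 0))); last by move=> p; rewrite inE.
rewrite -(pair_big xpredT (fun n => n != 0) (fun t n => h (t, n))) /= exchange_big /=.
rewrite (bigD1 (- b)) ?oppr_eq0 //= [X in _ + X]big1 ?addr0.
  rewrite (eq_bigr (fun x => psi (x * (1 + b / - b)))) // (sum_addchar_scale psi_ch).
  by rewrite invrN mulrN divff // subrr eqxx mulr1.
move=> n /andP[n0 nb]; rewrite (eq_bigr (fun x => psi (x * (1 + b / n)))) //.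
rewrite (sum_addchar_scale psi_ch) (_ : (_ == 0) = false) ?mulr0 //.
apply: contraNF nb => /eqP h0; rewrite -addr_eq0; apply/eqP.
by transitivity (n * (1 + b / n)); [field | rewrite h0 mulr0].
Qed.

End QuadExt.

(** * The Weil bound for Kloosterman sums *)

(** The Kloosterman sum attached to K over the extension of degree 2 ^ k, as
    dictated by kloosterman_quadratic. *)
Fixpoint kloosterman_rec (q : nat) (K : algC) (k : nat) : algC :=
  if k is k'.+1 then 2%:R * (q ^ (2 ^ k'))%:R - kloosterman_rec q K k' ^+ 2 else K.

(** The map tr is the trace of E over F, being the composite of the traces of the
    successive quadratic steps. *)
Lemma kloosterman_tower (F : finFieldType) (k : nat) : odd #|F| ->
  exists (E : finFieldType) (iota : {rmorphism F -> E}) (tr : E -> F),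
  [/\ #|E| = (#|F| ^ (2 ^ k))%N,
      forall x, iota (tr x) = \sum_(i < 2 ^ k) x ^+ (#|F| ^ i),
      forall psi, nontriv_addchar psi -> nontriv_addchar (psi \o tr) &
      forall psi b, nontriv_addchar psi -> b != 0 ->
        kloosterman (psi \o tr) (iota b)
          = kloosterman_rec #|F| (kloosterman psi b) k].
Proof.
move=> oddF; elim: k => [|k [E [iota [tr [oE trE tr_ch klE]]]]].
  exists F, (idfun : {rmorphism F -> F}), id.
  by split=> // x; rewrite big_ord1 /= expr1.
have oddE : odd #|E| by rewrite oE oddX oddF orbT.
have [E2 [j oE2]] := quadratic_extension oddE.
have [tr2 [nm2 [tr2E nm2E]]] := exists_trace_norm j oE2.
exists E2, (j \o iota : {rmorphism F -> E2}), (tr \o tr2); split.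
- by rewrite oE2 oE -expnM expnSr.
- move=> x /=; rewrite trE rmorph_sum expnS mul2n -addnn big_split_ord /= -big_split /=.
  apply: eq_bigr => i _; rewrite rmorphXn /= tr2E oE expnD exprM.
  apply: exprDn_pchar; apply: pnat_dvd (pchar_nat_card E2).
  by rewrite oE2 oE -expnM dvdn_exp2l // (leq_trans (ltnW (ltn_ord i))) // leq_pmulr.
- by move=> psi psi_ch; have := addchar_trace oE2 tr2E oddE (tr_ch _ psi_ch).
move=> psi b psi_ch b0; have ib0 : iota b != 0 by rewrite fmorph_eq0.
have := kloosterman_quadratic oE2 tr2E nm2E (tr_ch _ psi_ch) ib0.
by rewrite /= klE // oE.
Qed.

Lemma kloosterman_rec_real q K k :
  K \is Num.real -> kloosterman_rec q K k \is Num.real.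
Proof.
move=> K_real; elim: k => //= k IHk.
by rewrite rpredB ?rpredX // rpredM // realn.
Qed.

Lemma kloosterman_rec_le q K k : K \is Num.real ->
  kloosterman_rec q K k.+1 <= 2%:R * (q ^ (2 ^ k))%:R.
Proof.
by move=> K_real; rewrite /= gerBl real_exprn_even_ge0 // kloosterman_rec_real.
Qed.

(** Scaled by the square root of the field size, the recursion is
    x |-> 2 - x ^ 2, whose distance to the repelling fixed point -2 grows at
    least fourfold at each step below -2. *)
Lemma kloosterman_rec_blowup q K del k : 0 <= del ->
    4%:R * q%:R + del * q%:R <= K ^+ 2 ->
  kloosterman_rec q K k.+1 <= - ((2%:R + 4%:R ^+ k * del) * (q ^ (2 ^ k))%:R).
Proof.
move=> del0 hK; elim: k => [|k IHk].
  rewrite /= expn0 expn1 expr0 mul1r -subr_ge0.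
  have -> : - ((2%:R + del) * q%:R) - (2%:R * q%:R - K ^+ 2)
    = K ^+ 2 - (4%:R * q%:R + del * q%:R) by ring.
  by rewrite subr_ge0.
set s := (q ^ (2 ^ k))%N in IHk *; set e := 4%:R ^+ k * del in IHk.
have e0 : 0 <= e by rewrite mulr_ge0 ?exprn_ge0.
have -> : (q ^ (2 ^ k.+1))%N = (s ^ 2)%N by rewrite -expnM -expnSr.
have -> : kloosterman_rec q K k.+2
   = 2%:R * (s ^ 2)%:R - (- kloosterman_rec q K k.+1) ^+ 2.
  by rewrite sqrrN {1}/kloosterman_rec -/kloosterman_rec -expnM -expnSr.
move: IHk; rewrite lerNr; set x := - _ => hx.
have y0 : 0 <= (2%:R + e) * s%:R by rewrite mulr_ge0 ?addr_ge0.
have x2 : ((2%:R + e) * s%:R) ^+ 2 <= x ^+ 2.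
  by rewrite lerXn2r // nnegrE // (le_trans y0).
rewrite lerBlDr.
apply: (le_trans (y := - ((2%:R + 4%:R ^+ k.+1 * del) * (s ^ 2)%:R)
    + ((2%:R + e) * s%:R) ^+ 2)).
  rewrite -subr_ge0 natrX exprS -mulrA -/e.
  have -> : - ((2%:R + 4%:R * e) * s%:R ^+ 2) + ((2%:R + e) * s%:R) ^+ 2 -
    2%:R * s%:R ^+ 2 = (e * s%:R) ^+ 2 by ring.
  by rewrite exprn_ge0 // mulr_ge0.
by rewrite lerD2l.
Qed.

Lemma sum_kloosterman_card (F E : finFieldType) (psi : F -> algC) (tr : E -> F) b :
    nontriv_addchar psi ->
  \sum_(a : F) \sum_(x : E | x != 0) psi (a * tr (x + b / x))
    = (#|F| * #|[set x : E | (x != 0)%R & (tr (x + b / x) == 0)%R]|)%:R.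
Proof.
move=> psi_ch; rewrite exchange_big /=.
under eq_bigr do rewrite sum_addchar_scale //.
rewrite -mulr_sumr natrM; congr (_ * _).
rewrite -sum1_card natr_sum [RHS](eq_bigl (fun x => (x != 0) && (tr (x + b / x) == 0))).
  by rewrite big_mkcondr; apply: eq_bigr => x _; case: eqP.
by move=> x; rewrite inE.
Qed.

(** A lower bound for the number of zeros of the trace follows from the upper
    bounds of trace_fiber_bound for the other q - 1 values. *)
Lemma trace_zero_card (F E : finFieldType) (iota : {rmorphism F -> E})
    (tr : E -> F) (m : nat) (b : E) :
    odd #|F| -> (0 < m)%N -> #|E| = (#|F| ^ m.+1 * #|F| ^ m.+1)%N ->
    (forall x, iota (tr x) = \sum_(i < m.+1 + m.+1) x ^+ (#|F| ^ i)) ->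
  (#|E| <= #|F| * #|[set x : E | (x != 0)%R & (tr (x + b / x) == 0)%R]|
            + 3 * #|F| ^ 2 * #|F| ^ m.+1)%N.
Proof.
move=> oddF m_gt0 oE trE.
have q_gt2 : (2 < #|F|)%N by have := finNzRing_gt1 F; case: #|F| oddF => [|[|[]]].
pose N c := #|[set x : E | (x != 0)%R & (tr (x + b / x) == c)%R]|.
have N_le c : (N c <= (#|F| ^ m + 3) * #|F| ^ m.+1)%N.
  apply: leq_trans (trace_fiber_bound b (iota c) q_gt2 m_gt0 oE).
  apply/subset_leq_card/subsetP => x; rewrite !inE => /andP[-> /eqP <-] /=.
  by rewrite trE.
have N_sum : (\sum_c N c = #|E|.-1)%N.
  rewrite -card_neq0 -sum1_card (partition_big (fun x => tr (x + b / x)) xpredT) //=.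
  apply: eq_bigr => c _; rewrite sum1_card; apply: eq_card => x.
  by rewrite !inE.
rewrite (bigD1 0) //= in N_sum.
have : (\sum_(c | c != 0%R) N c <= #|F|.-1 * ((#|F| ^ m + 3) * #|F| ^ m.+1))%N.
  rewrite -card_neq0 -sum_nat_const; apply: leq_sum => c _; exact: N_le.
move: N_sum; rewrite -/(N 0) {N_le}; move: (N 0) (\sum_(c | _) _)%N => n0 n1.
have : (0 < #|F| ^ m)%N by rewrite expn_gt0; lia.
rewrite oE expnS; move: (#|F| ^ m)%N => rho; move: (#|F|) q_gt2 => q q_gt2.
move=> rho_gt0; set r := (q * rho)%N => h1 h2.
have r_gt0 : (0 < r)%N by rewrite muln_gt0 rho_gt0 andbT; lia.
have rr_gt0 : (0 < r * r)%N by rewrite muln_gt0 r_gt0.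
have h4 : (q * n1 <= q.-1 * (r * r + 3 * q * r))%N.
  apply: leq_trans (leq_mul (leqnn q) h2) _; rewrite mulnCA leq_mul2l.
  by apply/orP; right; rewrite /r; lia.
have h5 : (q * (r * r) = q * n0 + q * n1 + q)%N.
  by rewrite -mulnDr h1 -mulnSr prednK.
have h6 : (q.-1 * (r * r + 3 * q * r) + (r * r + 3 * q * r)
    = q * (r * r) + 3 * q ^ 2 * r)%N.
  by rewrite addnC -mulSn prednK ?expnS ?expn0; lia.
have h7 : (q <= 3 * q * r)%N by rewrite mulnAC leq_pmull // muln_gt0.
move: h4 h5 h6 h7; clear; move: (q.-1 * _)%N.
lia.
Qed.

(** Summed over all characters psi (a * _) with a in F, the Kloosterman sums of
    the extension count zeros of the trace, which trace_zero_card bounds from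
    below. As kloosterman_rec_le bounds each summand from above, no single one can be
    very negative. *)
Lemma kloosterman_rec_ge (F : finFieldType) (psi : F -> algC) (b : F) (k : nat) :
    odd #|F| -> nontriv_addchar psi -> b != 0 ->
  - (5%:R * #|F|%:R ^+ 2 * (#|F| ^ (2 ^ k.+1))%:R)
    <= kloosterman_rec #|F| (kloosterman psi b) k.+2.
Proof.
move=> oddF psi_ch b0.
have [E [iota [tr [oE trE tr_ch klE]]]] := kloosterman_tower k.+2 oddF.
set m1 := (2 ^ k.+1)%N.
have [m m_gt0 m1E] : exists2 m, (0 < m)%N & m1 = m.+1.
  exists m1.-1; last by rewrite prednK // expn_gt0.
  by rewrite -ltnS prednK ?expn_gt0 // (leq_trans _ (ltn_expl k.+1 _)).
have e2 : (2 ^ k.+2 = m.+1 + m.+1)%N by rewrite expnS -/m1 m1E mul2n addnn.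
rewrite e2 expnD in oE; rewrite e2 in trE.
have := trace_zero_card (iota b) oddF m_gt0 oE trE.
pose S (a : F) : algC := \sum_(x : E | x != 0) psi (a * tr (x + iota b / x)).
have : \sum_a S a = _ := sum_kloosterman_card tr (iota b) psi_ch.
set n0 := #|[set x | _ & _]| => hsum hn0.
rewrite (bigD1 0) //= (bigD1 1) ?oner_eq0 //= in hsum.
have S1 : S 1 = kloosterman_rec #|F| (kloosterman psi b) k.+2.
  by rewrite -klE //; apply: eq_bigr => x _; rewrite mul1r.
have S0 : S 0 = #|E|%:R - 1.
  rewrite /S; under eq_bigr do rewrite mul0r (addchar0 psi_ch).
  by rewrite sumr_const card_neq0 -subn1 natrB // ltnW // finNzRing_gt1.
rewrite S1 S0 in hsum.
have Sa : \sum_(a : F | (a != 0) && (a != 1)) S a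
    <= 2%:R * #|F|%:R ^+ 2 * (#|F| ^ m1)%:R.
  apply: (@le_trans _ _ (\sum_(a : F | (a != 0) && (a != 1)) 2%:R * (#|F| ^ m1)%:R)).
    apply: ler_sum => a /andP[a0 _].
    have psia := addchar_scale psi_ch a0.
    by rewrite -[S a]/(kloosterman ((fun x => psi (a * x)) \o tr) (iota b)) klE //
      kloosterman_rec_le // kloosterman_real.
  rewrite sumr_const -[_ *+ _]mulr_natl mulrA [_ * 2%:R]mulrC.
  rewrite ler_wpM2r // ler_wpM2l // -natrX ler_nat.
  by apply: (leq_trans (max_card _)); rewrite -{1}(expn1 #|F|) leq_exp2l // finNzRing_gt1.
move: hn0; rewrite -(ler_nat algC) natrD -hsum.
rewrite natrM (natrM _ 3) (natrX _ #|F| 2) -m1E => hn0.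
rewrite -subr_ge0 in hn0; rewrite -subr_ge0 in Sa; rewrite -subr_ge0.
have := addr_ge0 (addr_ge0 hn0 Sa) ler01.
set a := \sum_(a | _) _; set x := kloosterman_rec _ _ _.
set q2 := #|F|%:R ^+ 2; set r := (#|F| ^ m1)%:R.
suff -> : #|E|%:R - 1 + (x + a) + 3%:R * q2 * r - #|E|%:R
    + (2%:R * q2 * r - a) + 1 = x - - (5%:R * q2 * r) by [].
by ring.
Qed.

(** If K ^ 2 exceeded 4 q, the sums over the extensions of degree 2 ^ k would
    tend to minus infinity faster than kloosterman_rec_ge allows. *)
Theorem weil_kloosterman (F : finFieldType) (psi : F -> algC) (b : F) :
    odd #|F| -> nontriv_addchar psi -> b != 0 ->
  kloosterman psi b ^+ 2 <= 4%:R * #|F|%:R.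
Proof.
move=> oddF psi_ch b0; set K := kloosterman psi b.
have K_real : K \is Num.real by apply: kloosterman_real.
rewrite real_leNgt ?rpredX ?rpredM ?realn //; apply/negP => ltK.
set q := #|F| in ltK *.
have q_gt0 : (0 < q%:R :> algC) by rewrite ltr0n ltnW // finNzRing_gt1.
pose del := (K ^+ 2 - 4%:R * q%:R) / q%:R.
have del_gt0 : 0 < del by rewrite divr_gt0 // subr_gt0.
have delE : 4%:R * q%:R + del * q%:R <= K ^+ 2.
  by rewrite divfK ?gt_eqF // addrC subrK.
have c_ge0 : 0 <= 5%:R * q%:R ^+ 2 / del :> algC.
  by rewrite ltW // divr_gt0 // mulr_gt0 ?exprn_gt0.
set k := Num.bound (5%:R * q%:R ^+ 2 / del).
have hk : 5%:R * q%:R ^+ 2 < 4%:R ^+ k.+1 * del :> algC.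
  rewrite -ltr_pdivrMr // (lt_le_trans (archi_boundP c_ge0)) // -/k.
  by rewrite -natrX ler_nat (leq_trans (ltnW (ltn_expl k (isT : 1 < 4)%N))) // leq_exp2l.
have r_gt0 : (0 < (q ^ (2 ^ k.+1))%:R :> algC) by rewrite natrX exprn_gt0.
have := le_trans (kloosterman_rec_ge k oddF psi_ch b0)
  (kloosterman_rec_blowup k.+1 (ltW del_gt0) delE).
rewrite lerN2 ler_pM2r // => h.
have : 4%:R ^+ k.+1 * del <= 5%:R * q%:R ^+ 2 by apply: le_trans h; rewrite lerDr.
by move/(lt_le_trans hk); rewrite ltxx.
Qed.

(** * The quadratic character, Gauss sums and Salie sums *)

Section Quadratic.
Variable F : finFieldType.
Hypothesis oddF : odd #|F|.
Local Notation q := #|F|.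
Implicit Types (v s x y : F).

(** Counting square roots gives the quadratic character, extended by 0 at 0. *)
Definition quad_char (v : F) : algC := #|[set y : F | y ^+ 2 == v]|%:R - 1.

Lemma sqrt_set y : [set x : F | x ^+ 2 == y ^+ 2] = [set y; - y].
Proof. by apply/setP => x; rewrite !inE eqf_sqr. Qed.

Lemma quad_char_sqr y : y != 0 -> quad_char (y ^+ 2) = 1.
Proof.
move=> y0; have yN : y != - y.
  by rewrite -subr_eq0 opprK -[y + y]mulr2n -[y *+ 2]mulr_natl mulf_neq0 ?two_neq0.
by rewrite /quad_char sqrt_set cards2 yN /= [2%:R]mulrSr addrK.
Qed.

Lemma quad_char0 : quad_char 0 = 0.
Proof.
have := sqrt_set 0; rewrite expr0n /quad_char /= => ->.
by rewrite oppr0 cards2 eqxx subrr.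
Qed.

Lemma quad_char_nonsquare v : (forall y, y ^+ 2 != v) -> quad_char v = - 1.
Proof.
move=> hv; rewrite /quad_char (_ : [set _ | _] = set0) ?cards0 ?sub0r //.
by apply/setP => y; rewrite !inE (negPf (hv y)).
Qed.

Variant quad_char_spec v : algC -> Type :=
| QuadCharZero of v = 0 : quad_char_spec v 0
| QuadCharSquare y of y != 0 & v = y ^+ 2 : quad_char_spec v 1
| QuadCharNonsquare of v != 0 & (forall y, y ^+ 2 != v) : quad_char_spec v (-1).

Lemma quad_charP v : quad_char_spec v (quad_char v).
Proof.
have [->|v0] := eqVneq v 0; first by rewrite quad_char0; constructor.
case: (pickP [pred y : F | y ^+ 2 == v]) => [y /= /eqP e|h].
  have y0 : y != 0 by apply: contraNneq v0 => y0; rewrite -e y0 expr0n.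
  by rewrite -e quad_char_sqr //; apply: (QuadCharSquare y0).
have hv y : y ^+ 2 != v by have /= -> := h y.
by rewrite quad_char_nonsquare //; constructor.
Qed.

Lemma sum_sqr (f : F -> algC) : \sum_y f (y ^+ 2) = \sum_v (1 + quad_char v) * f v.
Proof.
rewrite (partition_big (fun y => y ^+ 2) xpredT) //=; apply: eq_bigr => v _.
rewrite (eq_bigr (fun=> f v)); last by move=> y /eqP->.
rewrite sumr_const /quad_char addrC subrK mulr_natl; congr (_ *+ _).
by apply: eq_card => y; rewrite !inE.
Qed.

Lemma sum_quad_char : \sum_v quad_char v = 0.
Proof.
have := sum_sqr (fun=> 1); under [in RHS]eq_bigr do rewrite mulr1.
by rewrite big_split /= => /eqP; rewrite -subr_eq0 opprD addrA subrr sub0r oppr_eq0 => /eqP.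
Qed.

Lemma quad_char_mul_sqr y v : y != 0 -> quad_char (y ^+ 2 * v) = quad_char v.
Proof.
move=> y0; rewrite /quad_char; congr (_%:R - 1).
rewrite -[RHS](card_imset _ (mulfI y0)); apply: eq_card => x.
rewrite inE; apply/eqP/imsetP => [hx|[z]].
  exists (y^-1 * x); rewrite ?mulVKf // inE exprMn hx exprVn.
  by rewrite mulKf ?expf_neq0.
by rewrite inE => /eqP <- ->; rewrite exprMn.
Qed.

(** Each quad_char (u * w) + quad_char w is nonpositive when u is not a square, and these
    terms sum to zero. *)
Lemma quad_char_mul_nonsquare u v : (forall y, y ^+ 2 != u) ->
  quad_char (u * v) = - quad_char v.
Proof.
move=> hu; have u0 : u != 0 by have := hu 0; rewrite expr0n eq_sym.
have le0 w : 0 <= - (quad_char (u * w) + quad_char w).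
  case: (quad_charP w) => [->|y y0 ->|w0 hw].
  - by rewrite mulr0 quad_char0 addr0 oppr0.
  - by rewrite mulrC quad_char_mul_sqr // quad_char_nonsquare // addNr oppr0.
  rewrite opprD opprK; by case: (quad_charP (u * w)) => *;
    rewrite ?opprK ?addNr ?oppr0 ?add0r ?ler01 // addr_ge0.
have sum0 : \sum_w - (quad_char (u * w) + quad_char w) = 0.
  rewrite sumrN big_split /= sum_quad_char addr0.
  by have := sum_quad_char; rewrite (reindex_inj (mulfI u0)) /= => ->; rewrite oppr0.
have /eqP := psumr_eq0P (fun w _ => le0 w) sum0 (i := v) isT.
by rewrite oppr_eq0 addr_eq0 => /eqP.
Qed.

Lemma quad_charM u v : quad_char (u * v) = quad_char u * quad_char v.
Proof.
case: (quad_charP u) => [->|y y0 ->|u0 hu].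
- by rewrite !mul0r quad_char0.
- by rewrite mul1r quad_char_mul_sqr.
by rewrite quad_char_mul_nonsquare // mulN1r.
Qed.

Lemma quad_char_sq1 v : v != 0 -> quad_char v ^+ 2 = 1.
Proof.
by case: (quad_charP v) => [->|y y0 ->|u0 hu]; rewrite ?eqxx // ?expr1n // sqrrN expr1n.
Qed.

Lemma quad_char_norm_sq v : v != 0 -> `|quad_char v| ^+ 2 = 1.
Proof.
by case: (quad_charP v) => [->|y y0 ->|u0 hu]; rewrite ?eqxx // ?normrN normr1 expr1n.
Qed.

Lemma quad_charV v : v != 0 -> quad_char v^-1 = quad_char v.
Proof.
by move=> v0; rewrite -(quad_char_mul_sqr (y := v) _ v0) expr2 -mulrA divff // mulr1.
Qed.

Section Gauss.
Variable psi : F -> algC.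
Hypothesis psi_ch : nontriv_addchar psi.

Definition gauss : algC := \sum_v quad_char v * psi v.

Lemma gauss_scale s : s != 0 -> \sum_v quad_char v * psi (s * v) = quad_char s * gauss.
Proof.
move=> s0; rewrite (reindex_inj (mulfI (invr_neq0 s0))) mulr_sumr /=.
by apply: eq_bigr => v _; rewrite mulVKf // quad_charM quad_charV // mulrA.
Qed.

Lemma sum_psi_sqr s : s != 0 -> \sum_y psi (s * y ^+ 2) = quad_char s * gauss.
Proof.
move=> s0; rewrite (sum_sqr (fun v => psi (s * v))).
under eq_bigr do rewrite mulrDl mul1r.
rewrite big_split /= gauss_scale // (eq_bigr (fun v => psi (v * s))); last first.
  by move=> v _; rewrite mulrC.
by rewrite (sum_addchar_scale psi_ch) (negPf s0) mulr0 add0r.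
Qed.

Lemma sum_psi_quadratic s m : s != 0 ->
  \sum_y psi (s * y ^+ 2 + m * y) = psi (- (m ^+ 2 / 4%:R) / s) * (quad_char s * gauss).
Proof.
move=> s0; have two0 := two_neq0 oddF.
rewrite -sum_psi_sqr // mulr_sumr (reindex_inj (addIr (- (m / (2%:R * s))))) /=.
apply: eq_bigr => y _; rewrite -(addcharD psi_ch); congr psi.
have four0 : (4%:R : F) != 0 by rewrite (natrM _ 2 2) mulf_neq0.
by field; rewrite s0 four0 two0.
Qed.

Lemma gauss_norm : `|gauss| ^+ 2 = q%:R.
Proof.
have -> : gauss = \sum_y psi (y ^+ 2).
  have := sum_psi_sqr (oner_neq0 F); rewrite -[X in quad_char X](expr1n F 2) quad_char_sqr ?oner_neq0 //.
  by rewrite mul1r => <-; apply: eq_bigr => y _; rewrite mul1r.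
rewrite normCK rmorph_sum mulr_sumr /=.
transitivity (\sum_y \sum_u psi (u ^+ 2) * psi (y * (2%:R * u))).
  apply: eq_bigr => y _; rewrite mulr_suml (reindex_inj (addIr y)) /=.
  apply: eq_bigr => u _; rewrite -(addcharN psi_ch) -!(addcharD psi_ch).
  by congr psi; ring.
rewrite exchange_big /=.
under eq_bigr do rewrite -mulr_sumr (sum_addchar_scale psi_ch).
rewrite (bigD1 0) //= [X in _ + X]big1 ?addr0.
  by rewrite expr0n mulr0 eqxx mulr1 (addchar0 psi_ch) mul1r.
by move=> u u0; rewrite mulf_eq0 (negPf u0) (negPf (two_neq0 oddF)) !mulr0.
Qed.

Lemma addchar_norm x : `|psi x| = 1.
Proof.
apply/eqP; rewrite -(@eqrXn2 _ 2) // expr1n normCK -(addcharN psi_ch).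
by rewrite -(addcharD psi_ch) subrr (addchar0 psi_ch).
Qed.

(** If s + s^-1 = v then s (v + 2) = (s + 1) ^ 2, so s and v + 2 have the same
    quadratic character unless s = -1; and such s exist in number
    1 + quad_char (v ^ 2 - 4). *)
Lemma sum_quad_char_joukowski v :
  \sum_(s | (s != 0) && (s + s^-1 == v)) quad_char s
    = quad_char (v + 2%:R) + quad_char (v - 2%:R).
Proof.
have two0 := two_neq0 oddF.
have four0 : (4%:R : F) != 0 by rewrite (natrM _ 2 2) mulf_neq0.
have [->|v2] := eqVneq v (- 2%:R).
  rewrite addNr quad_char0 add0r (big_pred1 (-1)).
    rewrite (_ : _ - _ = 2%:R ^+ 2 * -1); last by ring.
    by rewrite quad_char_mul_sqr.
  move=> s /=; apply/andP/eqP => [[s0 /eqP hs]|->].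
    have : (s + 1) ^+ 2 = 0.
      by transitivity (s * (s + s^-1 + 2%:R)); [field | rewrite hs addNr mulr0].
    by move/eqP; rewrite expf_eq0 addr_eq0 => /eqP.
  by rewrite oppr_eq0 oner_neq0 invrN1; split=> //; apply/eqP; ring.
have vp : v + 2%:R != 0 by rewrite addr_eq0.
have -> : \sum_(s | (s != 0) && (s + s^-1 == v)) quad_char s
   = \sum_(s | (s != 0) && (s + s^-1 == v)) quad_char (v + 2%:R).
  apply: eq_bigr => s /andP[s0 /eqP hs].
  have -> : v + 2%:R = ((s + 1) / s) ^+ 2 * s by rewrite -hs; field.
  rewrite quad_char_mul_sqr // mulf_neq0 ?invr_eq0 // addr_eq0.
  apply: contraNneq v2 => s1; rewrite -hs s1 invrN1; apply/eqP; ring.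
rewrite sumr_const -[LHS]mulr_natl.
have -> : #|[pred s : F | (s != 0) && (s + s^-1 == v)]|%:R = 1 + quad_char (v ^+ 2 - 4%:R).
  rewrite /quad_char addrC subrK; congr _%:R.
  (* completing the square: s |-> 2 s - v maps solutions to square roots *)
  have aff_inj : injective (fun s : F => 2%:R * s - v).
    by move=> x y /addIr/(mulfI two0).
  rewrite -[LHS](card_imset _ aff_inj); apply: eq_card => y.
  rewrite [RHS]inE; apply/imsetP/eqP => [[s]|hy].
    by rewrite inE => /andP[s0 /eqP <-] ->; field.
  have hs : ((y + v) / 2%:R) * (v - (y + v) / 2%:R) = 1.
    transitivity ((v ^+ 2 - y ^+ 2) / 4%:R); first by field; rewrite two0 four0.
    by rewrite hy opprB addrC subrK divff.
  exists ((y + v) / 2%:R); last by field.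
  have s0 : (y + v) / 2%:R != 0.
    by apply: contraTneq (oner_neq0 F) => s0; rewrite -hs s0 mul0r eqxx.
  rewrite inE s0 /=; apply/eqP; apply: (mulfI s0).
  by rewrite mulrDr divff // -[X in _ + X]hs; ring.
rewrite mulrDl mul1r (_ : v ^+ 2 - _ = (v - 2%:R) * (v + 2%:R)); last by ring.
by rewrite quad_charM -mulrA -expr2 quad_char_sq1 // mulr1.
Qed.

Lemma salie_symmetric c : c != 0 ->
  \sum_(s | s != 0) quad_char s * psi (c * (s + s^-1))
    = (psi (- (2%:R * c)) + psi (2%:R * c)) * (quad_char c * gauss).
Proof.
move=> c0; rewrite (partition_big (fun s => s + s^-1) xpredT) //=.
under eq_bigr => v _ do
  (under eq_bigr => s /andP[_ /eqP->] do []; rewrite -mulr_suml sum_quad_char_joukowski mulrDl).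
rewrite big_split /= mulrDl; congr (_ + _).
  rewrite (reindex_inj (addIr (- 2%:R))) /= -gauss_scale // mulr_sumr.
  apply: eq_bigr => v _; rewrite subrK mulrCA -(addcharD psi_ch); congr (_ * psi _).
  by ring.
rewrite (reindex_inj (addIr 2%:R)) /= -gauss_scale // mulr_sumr.
apply: eq_bigr => v _; rewrite addrK mulrCA -(addcharD psi_ch); congr (_ * psi _).
by ring.
Qed.

(** The involution s |-> b / (a s) shows that the sum vanishes unless
    a b = c ^ 2, and then a rescaling reduces it to salie_symmetric. *)
Lemma salie_bound a b : a != 0 ->
  `|\sum_(s | s != 0) quad_char s * psi (a * s + b / s)| ^+ 2 <= 4%:R * q%:R.
Proof.
move=> a0; have [->|b0] := eqVneq b 0.
  rewrite (eq_bigr (fun s => quad_char s * psi (a * s))); last by move=> s _; rewrite mul0r addr0.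
  have := gauss_scale a0; rewrite (bigD1 0) //= quad_char0 mul0r add0r => ->.
  by rewrite normrM exprMn quad_char_norm_sq // mul1r gauss_norm ler_peMl // ler1n.
set T := \sum_(s | _) _.
case: (quad_charP (a * b)) => [/eqP|c c0 abE|_ hab]; first by rewrite mulf_eq0 (negPf a0) (negPf b0).
  have -> : T = quad_char (c / a) * \sum_(s | s != 0) quad_char s * psi (c * (s + s^-1)).
    have ca0 : c / a != 0 by rewrite mulf_neq0 ?invr_eq0.
    rewrite /T (reindex_inj (mulfI ca0)) mulr_sumr /=; apply: eq_big => [s|s].
      by rewrite mulf_eq0 (negPf ca0).
    rewrite mulf_eq0 (negPf ca0) /= => s0.
    rewrite [quad_char (c / a * s)]quad_charM -[LHS]mulrA; congr (_ * (_ * psi _)).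
    have -> : b = c ^+ 2 / a by rewrite -abE mulrC mulKf.
    by field; rewrite a0 s0 c0.
  rewrite salie_symmetric // !normrM !exprMn !quad_char_norm_sq ?mulf_neq0 ?invr_eq0 //.
  rewrite !mul1r gauss_norm ler_wpM2r // (natrX _ 2 2) lerXn2r ?nnegrE //.
  by rewrite (le_trans (ler_normD _ _)) // !addchar_norm.
have : T = - T.
  have ba0 : b / a != 0 by rewrite mulf_neq0 ?invr_eq0.
  have inj : injective (fun s : F => b / a / s) by move=> x y /(mulfI ba0)/invr_inj.
  rewrite {1}/T (reindex_inj inj) -sumrN /=; apply: eq_big => [s|s].
    by rewrite mulf_eq0 (negPf ba0) invr_eq0.
  rewrite mulf_eq0 (negPf ba0) invr_eq0 /= => s0.
  have -> : b / a / s = ((a * s)^-1) ^+ 2 * ((a * b) * s) by field; rewrite a0 s0.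
  rewrite quad_char_mul_sqr ?invr_eq0 ?mulf_neq0 // quad_charM (quad_char_nonsquare hab) mulN1r mulNr.
  by congr (- (_ * psi _)); field; rewrite a0 s0 b0.
move/eqP; rewrite -subr_eq0 opprK -mulr2n mulrn_eq0 /= => /eqP ->.
by rewrite normr0 expr0n mulr_ge0.
Qed.

Lemma kloosterman_bound a b : a != 0 ->
  `|\sum_(s | s != 0) psi (a * s + b / s)| ^+ 2 <= 4%:R * q%:R.
Proof.
move=> a0; have [->|b0] := eqVneq b 0.
  rewrite (eq_bigr (fun s => psi (s * a))); last by move=> s _; rewrite mul0r addr0 mulrC.
  have := sum_addchar_scale psi_ch a; rewrite (bigD1 0) //= mul0r (addchar0 psi_ch).
  rewrite (negPf a0) mulr0 addrC => /eqP; rewrite addr_eq0 => /eqP ->.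
  by rewrite normrN normr1 expr1n -natrM ler1n muln_gt0 /= ltnW // finNzRing_gt1.
have -> : \sum_(s | s != 0) psi (a * s + b / s) = kloosterman psi (a * b).
  rewrite (reindex_inj (mulfI (invr_neq0 a0))) /=; apply: eq_big => [s|s].
    by rewrite mulf_eq0 invr_eq0 (negPf a0).
  rewrite mulf_eq0 invr_eq0 (negPf a0) /= => s0; congr psi.
  by field; rewrite a0 s0.
rewrite real_normK ?kloosterman_real //.
by apply: weil_kloosterman; rewrite // mulf_neq0.
Qed.

(** Only the parity of d matters: even d gives Kloosterman sums, odd d gives
    Salie sums. *)
Lemma twisted_kloosterman_bound d a b : a != 0 ->
  `|\sum_(s | s != 0) quad_char s ^+ d * psi (a * s + b / s)| ^+ 2 <= 4%:R * q%:R.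
Proof.
move=> a0; have etad s : s != 0 -> quad_char s ^+ d = quad_char s ^+ odd d.
  move=> s0; rewrite -{1}(odd_double_half d) exprD -mul2n exprM quad_char_sq1 //.
  by rewrite expr1n mulr1.
rewrite (eq_bigr (fun s => quad_char s ^+ odd d * psi (a * s + b / s))); last first.
  by move=> s s0; rewrite etad.
case: (odd d) => /=; first exact: salie_bound.
under eq_bigr do rewrite expr0 mul1r.
exact: kloosterman_bound.
Qed.

End Gauss.
End Quadratic.

(** * Fourier analysis and pairs of sets without a given distance *)

Section Fourier.
Variables (F : finFieldType) (psi : F -> algC) (d : nat).
Hypothesis psi_ch : nontriv_addchar psi.
Local Notation V := 'rV[F]_d.
Local Notation q := #|F|.
Implicit Types (x y m : V) (f g : V -> algC).

Definition dotp m x : F := \sum_i m ord0 i * x ord0 i.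

Definition fourier f m : algC := \sum_x f x * psi (dotp m x).

Lemma addchar_sum (I : finType) (G : I -> F) :
  psi (\sum_i G i) = \prod_i psi (G i).
Proof.
by apply: (big_morph psi); [exact: addcharD psi_ch | exact: addchar0 psi_ch].
Qed.

Lemma dotpDr m x y : dotp m (x + y) = dotp m x + dotp m y.
Proof. by rewrite -big_split /=; apply: eq_bigr => i _; rewrite mxE mulrDr. Qed.

Lemma dotpNr m x : dotp m (- x) = - dotp m x.
Proof. by rewrite -sumrN; apply: eq_bigr => i _; rewrite mxE mulrN. Qed.

Lemma sum_rV_prod (h : 'I_d -> F -> algC) :
  \sum_(x : V) \prod_i h i (x ord0 i) = \prod_i \sum_v h i v.
Proof.
rewrite bigA_distr_bigA /=.
pose to_ffun (x : V) := [ffun i => x ord0 i].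
rewrite (reindex to_ffun) /=.
  by apply: eq_bigr => x _; apply: eq_bigr => i _; rewrite ffunE.
exists (fun f : {ffun 'I_d -> F} => \row_i f i) => [x _|f _].
  by apply/rowP => i; rewrite mxE ffunE.
by apply/ffunP => i; rewrite ffunE mxE.
Qed.

Lemma sum_addchar_dotp x : \sum_m psi (dotp m x) = (q ^ d)%:R * (x == 0)%:R.
Proof.
under eq_bigr do rewrite /dotp addchar_sum.
rewrite (sum_rV_prod (fun i v => psi (v * x ord0 i))).
under eq_bigr do rewrite (sum_addchar_scale psi_ch).
have [->|x0] := eqVneq x 0.
  under eq_bigr do rewrite mxE eqxx mulr1.
  by rewrite prodr_const card_ord mulr1 natrX.
have [i xi] := rV0Pn _ x0.
by rewrite (bigD1 i) //= (negPf xi) !mulr0 mul0r.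
Qed.

Lemma plancherel f :
  \sum_m `|fourier f m| ^+ 2 = (q ^ d)%:R * \sum_x `|f x| ^+ 2.
Proof.
transitivity (\sum_m \sum_x \sum_y (f x * (f y)^*) * psi (dotp m (x - y))).
  apply: eq_bigr => m _; rewrite normCK rmorph_sum mulr_suml /=.
  apply: eq_bigr => x _; rewrite mulr_sumr; apply: eq_bigr => y _.
  rewrite rmorphM dotpDr dotpNr (addcharD psi_ch) (addcharN psi_ch) /=.
  by rewrite mulrACA.
rewrite exchange_big mulr_sumr /=; apply: eq_bigr => x _.
rewrite exchange_big (bigD1 x) //= [X in _ + X]big1 ?addr0 => [|y yx].
  by rewrite -mulr_sumr sum_addchar_dotp subrr eqxx mulr1 mulrC normCK.
by rewrite -mulr_sumr sum_addchar_dotp subr_eq0 eq_sym (negPf yx) !mulr0.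
Qed.

Lemma fourier_convolution f g m :
  fourier (fun x => \sum_y f (x - y) * g y) m = fourier f m * fourier g m.
Proof.
rewrite mulr_sumr [LHS](eq_bigr (fun x => \sum_y f (x - y) * g y * psi (dotp m x)));
  last by move=> x _; rewrite mulr_suml.
rewrite exchange_big /=; apply: eq_bigr => y _.
rewrite mulr_suml (reindex_inj (addIr y)) /=; apply: eq_bigr => x _.
by rewrite addrK dotpDr (addcharD psi_ch) mulrACA.
Qed.

End Fourier.

Section Spheres.
Variables (F : finFieldType) (d : nat).
Hypothesis oddF : odd #|F|.
Local Notation V := 'rV[F]_d.
Local Notation q := #|F|.

(** Up to the factor #|F| and the term s = 0, the indicator function of the
    sphere of radius r. *)
Definition sphere_kernel (psi : F -> algC) (r : F) (x : V) : algC :=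
  \sum_(s | s != 0) psi (s * (sqnorm x - r)).

(** For each s the exponential sum over x factors into d quadratic Gauss sums,
    leaving a Kloosterman or Salie sum over s. *)
Lemma fourier_sphere_kernel psi r m : nontriv_addchar psi ->
  fourier psi (sphere_kernel psi r) m
  = gauss psi ^+ d * \sum_(s | s != 0)
      quad_char s ^+ d * psi (- r * s + (- (sqnorm m / 4%:R)) / s).
Proof.
move=> psi_ch; rewrite /fourier; under eq_bigr do rewrite mulr_suml.
rewrite exchange_big mulr_sumr /=; apply: eq_bigr => s s0.
pose h i y := psi (s * y ^+ 2 + m ord0 i * y).
rewrite (eq_bigr (fun x : V => psi (- r * s) * \prod_i h i (x ord0 i))); last first.
  move=> x _; rewrite -(addchar_sum psi_ch) -!(addcharD psi_ch); congr psi.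
  by rewrite big_split /= -mulr_sumr /sqnorm /dotp; ring.
rewrite -mulr_sumr sum_rV_prod.
under eq_bigr do rewrite sum_psi_quadratic //.
rewrite big_split /= -(addchar_sum psi_ch) prodr_const card_ord exprMn.
rewrite [LHS]mulrA -(addcharD psi_ch) [LHS]mulrC [_ * gauss psi ^+ d]mulrC -[LHS]mulrA.
congr (_ * (_ * psi (_ + _))).
by rewrite -mulr_suml sumrN -mulr_suml.
Qed.

(** Convolve the sphere kernel with the indicator of U. At a point of D no
    element of U is at distance r, so each kernel value is the full character
    sum 0 minus the term 1 at s = 0, and the convolution equals - #|U|. Hence
    #|D| * #|U| ^ 2 is at most its squared L2 norm, and that norm is at most
    4 * q ^ d.+1 * #|U| by Plancherel and the bound on the Fourier transform of
    the kernel. *)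
Theorem sphere_hole_bound (r : F) (D U : {set V}) : r != 0 ->
    (forall x u, x \in D -> u \in U -> sqnorm (x - u) != r) ->
  (#|D| * #|U| <= 4 * q ^ d.+1)%N.
Proof.
move=> r0 DU; have [psi psi_ch] := exists_addchar F.
pose k := sphere_kernel psi r; pose oneU (u : V) : algC := (u \in U)%:R.
pose w (x : V) := \sum_u k (x - u) * oneU u.
have wD x : x \in D -> w x = - #|U|%:R.
  move=> xD; rewrite /w (eq_bigr (fun u => - oneU u)) => [|u _].
    by rewrite sumrN -sum1_card natr_sum [in RHS]big_mkcond; congr (- _); apply: eq_bigr => u _;
      rewrite /oneU; case: (u \in U).
  rewrite /oneU; case uU: (u \in U); last by rewrite mulr0 oppr0.
  rewrite mulr1; apply/eqP; rewrite -subr_eq0 opprK addrC; apply/eqP.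
  have := sum_addchar_scale psi_ch (sqnorm (x - u) - r).
  rewrite subr_eq0 (negPf (DU x u xD uU)) mulr0 (bigD1 0) //= mul0r.
  by rewrite (addchar0 psi_ch).
have k_le m : `|fourier psi k m| ^+ 2 <= (4 * q ^ d.+1)%:R.
  rewrite fourier_sphere_kernel // normrM exprMn normrX -exprM mulnC exprM.
  rewrite gauss_norm // expnS mulnA mulnC natrM natrX ler_wpM2l ?exprn_ge0 //.
  by rewrite natrM twisted_kloosterman_bound // oppr_eq0.
have sumU : \sum_u `|oneU u| ^+ 2 = #|U|%:R.
  rewrite -sum1_card natr_sum [RHS]big_mkcond; apply: eq_bigr => u _.
  by rewrite /oneU; case: (u \in U); rewrite ?normr1 ?normr0 ?expr1n ?expr0n.
have qd_gt0 : (0 < (q ^ d)%:R :> algC).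
  by rewrite ltr0n expn_gt0 ltnW // finNzRing_gt1.
have w_le : \sum_x `|w x| ^+ 2 <= (4 * q ^ d.+1)%:R * #|U|%:R.
  rewrite -(ler_pM2l qd_gt0) -(plancherel psi_ch) mulrCA -sumU -(plancherel psi_ch).
  rewrite mulr_sumr; apply: ler_sum => m _.
  by rewrite (fourier_convolution psi_ch) normrM exprMn ler_wpM2r ?exprn_ge0.
have w_ge : #|D|%:R * #|U|%:R ^+ 2 <= \sum_x `|w x| ^+ 2.
  rewrite (bigID (mem D)) /= (eq_bigr (fun=> #|U|%:R ^+ 2)); last first.
    by move=> x xD; rewrite wD // normrN normr_nat.
  by rewrite sumr_const mulr_natl lerDl sumr_ge0 // => x _; rewrite exprn_ge0.
have := le_trans w_ge w_le; rewrite -natrX -!natrM ler_nat.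
move=> h.
case: (posnP #|U|) => [->|U_gt0]; first by rewrite muln0.
by rewrite -(leq_pmul2r U_gt0) -mulnA.
Qed.

End Spheres.

(** * Depth-first search for coloured paths *)

Section DepthFirstSearch.
Variables (T C : finType) (e : C -> rel T) (c : nat -> C).

(** The path is kept with its last vertex first, because the search extends and
    shortens it at that end; c i is the colour wanted between the vertices of
    index i and i.+1 counted from the start. *)
Fixpoint coloured_stack (p : seq T) : bool :=
  if p is x :: p' then
    if p' is y :: _ then e (c (size p').-1) y x && coloured_stack p' else true
  else true.

Lemma coloured_stack_nth x0 p i : coloured_stack p -> (i.+1 < size p)%N ->
  e (c i) (nth x0 (rev p) i) (nth x0 (rev p) i.+1).
Proof.
elim: p i => [|x [|y p'] IHp] i //= /andP[exy okp] lti.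
rewrite rev_cons !nth_rcons size_rev /=.
move: lti; rewrite !ltnS leq_eqVlt => /orP[/eqP->|lti].
  by rewrite ltnn !eqxx /= rev_cons nth_rcons size_rev ltnn eqxx.
by rewrite lti orbT IHp.
Qed.

Variables (R : {set C}) (S : {set T}) (L : nat).
Hypothesis cR : forall i, c i \in R.

(** State of the search after n moves: p is the current path, U the set of
    unvisited vertices, and D the set of abandoned ones. A vertex x is abandoned
    when it has no neighbour in U of the colour then required, which col x
    records; U only shrinks afterwards. Each move either takes a vertex out of
    U or puts one into D, which is what dfs_step counts. *)
Record dfs_state (n : nat) (p : seq T) (D U : {set T}) (col : T -> C) : Prop := {
  dfs_size : (size p <= L)%N;
  dfs_uniq : uniq p;
  dfs_coloured : coloured_stack p;
  dfs_partition : forall x, ((x \in p) + (x \in D) + (x \in U) = (x \in S))%N;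
  dfs_step : (#|D| + #|S| = n + #|U|)%N;
  dfs_colR : forall x, x \in D -> col x \in R;
  dfs_dead : forall x u, x \in D -> u \in U -> ~~ e (col x) x u
}.

Definition has_coloured_path := exists p : seq T,
  [/\ size p = L, uniq p, {subset p <= S} & coloured_stack p].

Lemma dfs_run (n : nat) : (0 < L)%N -> (n <= #|S|)%N ->
  has_coloured_path \/
  exists p D U col, dfs_state n p D U col /\ (size p < L)%N.
Proof.
move=> L_gt0; elim: n => [_|n IHn ltn].
  right; exists [::], set0, S, (fun=> c 0); split=> //; split=> //.
  - by move=> x; rewrite in_set0.
  - by rewrite cards0.
  - by move=> x u; rewrite in_set0.
case: (IHn (ltnW ltn)) => [|[p [D [U [col [st ltp]]]]]]; first by left.
have push u : u \in U -> coloured_stack (u :: p) -> has_coloured_path \/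
    exists p D U col, dfs_state n.+1 p D U col /\ (size p < L)%N.
  move=> uU okup.
  have [up uD uS] : [/\ u \notin p, u \notin D & u \in S].
    by have := dfs_partition st u; rewrite uU; case: (u \in p); case: (u \in D);
      case: (u \in S).
  have pS x : x \in u :: p -> x \in S.
    rewrite inE => /predU1P[->//|xp]; have := dfs_partition st x.
    by rewrite xp; case: (x \in S); rewrite // !addSn.
  have uniq_up : uniq (u :: p) by rewrite /= up (dfs_uniq st).
  have := ltp; rewrite leq_eqVlt => /orP[/eqP eq_up|lt_up].
    by left; exists (u :: p).
  right; exists (u :: p), D, (U :\ u), col; split=> //; split=> //.
  - move=> x; rewrite -(dfs_partition st x) !inE; have [->|//] := eqVneq x u.
    by rewrite (negPf up) (negPf uD) uU.
  - by have := dfs_step st; rewrite (cardsD1 u U) uU; lia.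
  - exact: (dfs_colR st).
  by move=> x v xD; rewrite !inE => /andP[_ vU]; exact: (dfs_dead st).
have [u0 u0U] : exists u, u \in U.
  apply/set0Pn; rewrite -cards_eq0; apply/negP => /eqP U0.
  by have := dfs_step st; rewrite U0; lia.
case: p st ltp push => [|y p] st ltp push; first exact: (push u0).
case: (pickP [pred u | (u \in U) && e (c (size (y :: p)).-1) y u]) => [u|noext].
  by move=> /andP[uU eyu]; apply: (push u uU); rewrite /= eyu; exact: (dfs_coloured st).
right; exists p, (y |: D), U, (fun x => if x == y then c (size p) else col x).
have /= /andP[yp uniqp] := dfs_uniq st.
have [yD yU yS] : [/\ y \notin D, y \notin U & y \in S].
  have := dfs_partition st y; rewrite mem_head.
  by case: (y \in D); case: (y \in U); case: (y \in S).
split; last exact: ltnW.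
split=> //.
- by rewrite ltnW // ltnW.
- by have := dfs_coloured st; case: (p) => //= z p' /andP[].
- move=> x; rewrite -(dfs_partition st x) !inE; have [->|//] := eqVneq x y.
  by rewrite (negPf yp) (negPf yD) (negPf yU).
- by rewrite cardsU1 yD addSn -addnA addSn add0n (dfs_step st).
- move=> x; rewrite !inE; case: eqP => //= _; exact: (dfs_colR st).
move=> x u; rewrite !inE; case: eqP => [->|_] /= xD uU; last exact: (dfs_dead st).
by have := noext u; rewrite /= uU /= => ->.
Qed.

(** Stop after #|S| moves, when #|D| = #|U| = k. Splitting D by colour gives
    k ^ 2 <= #|R| * B, while the path has #|S| - 2 k vertices. *)
Lemma coloured_path_of_holes (B : nat) : (0 < L)%N ->
    (forall r (D U : {set T}), r \in R ->
       (forall x u, x \in D -> u \in U -> ~~ e r x u) -> (#|D| * #|U| <= B)%N) ->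
    (forall k, (k * k <= #|R| * B)%N -> (L + 2 * k <= #|S|)%N) ->
  has_coloured_path.
Proof.
move=> L_gt0 hole largeS.
case: (dfs_run L_gt0 (leqnn _)) => // -[p [D [U [col [st ltp]]]]].
have eqDU : #|D| = #|U| by have := dfs_step st; lia.
have cardS : (size p + #|D| + #|U| = #|S|)%N.
  rewrite -(card_uniqP (dfs_uniq st)) -!sum1_card.
  rewrite [X in (X + _ + _)%N]big_mkcond [X in (_ + X + _)%N]big_mkcond.
  rewrite [X in (_ + _ + X)%N]big_mkcond [RHS]big_mkcond -!big_split /=.
  apply: eq_bigr => x _; have := dfs_partition st x.
  by case: (x \in p); case: (x \in D); case: (x \in U); case: (x \in S).
have DU_le : (#|D| * #|U| <= #|R| * B)%N.
  have -> : (#|D| * #|U| = \sum_(r in R) #|[set x in D | col x == r]| * #|U|)%N.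
    rewrite -big_distrl /= -sum1_card (partition_big col (mem R)) /=.
      congr (_ * _)%N; apply: eq_bigr => r _; rewrite sum1_card; apply: eq_card => x.
      by rewrite !inE.
    exact: (dfs_colR st).
  rewrite -sum_nat_const; apply: leq_sum => r rR; apply: (hole r) => // x u.
  by rewrite inE => /andP[xD /eqP <-] uU; exact: (dfs_dead st).
rewrite eqDU in DU_le cardS.
by have := largeS _ DU_le; rewrite -cardS; lia.
Qed.

End DepthFirstSearch.


(** * Distance paths in large sets *)

Lemma sqnormN (F : finFieldType) (d : nat) (x : 'rV[F]_d) : sqnorm (- x) = sqnorm x.
Proof. by apply: eq_bigr => i _; rewrite mxE sqrrN. Qed.

Lemma mem_zip_behead (V : eqType) (x0 : V) (s : seq V) (ab : V * V) :
  ab \in zip s (behead s) ->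
  exists2 i, (i.+1 < size s)%N & ab = (nth x0 s i, nth x0 s i.+1).
Proof.
case/(nthP (x0, x0)) => i; rewrite size_zip size_behead leq_min => /andP[_ lti] <-.
have lti' : (i.+1 < size s)%N by lia.
exists i => //; rewrite nth_zip_cond size_zip size_behead.
by rewrite (_ : (i < _)%N) ?nth_behead //; lia.
Qed.

Lemma set2_inj (V : finType) (u v a b : V) :
  [set u; v] = [set a; b] -> (u = a /\ v = b) \/ (u = b /\ v = a).
Proof.
move=> h; have : u \in [set a; b] by rewrite -h set21.
have : v \in [set a; b] by rewrite -h set22.
have : a \in [set u; v] by rewrite h set21.
have : b \in [set u; v] by rewrite h set22.
rewrite !inE => /orP[] /eqP hb /orP[] /eqP ha /orP[] /eqP hv /orP[] /eqP hu;
  subst; by [left | right].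
Qed.

Lemma contains_dist_path_of_stack (F : finFieldType) (d : nat) (R : {set F})
    (S : {set 'rV[F]_d}) (P : dist_path R) :
    R != set0 ->
    (forall c : nat -> F, (forall i, c i \in R) ->
      has_coloured_path (fun r (x y : 'rV[F]_d) => sqnorm (x - y) == r) c S
        #|dp_vertex P|) ->
  contains_dist_path S P.
Proof.
case/set0Pn => r0 r0R hpath.
case: (dp_is_path P) => s [s0 uniq_s mem_s edgesE].
have size_s : size s = #|dp_vertex P|.
  by rewrite -(card_uniqP uniq_s); apply: eq_card => v; rewrite mem_s.
have [v0 _] : exists v0 : dp_vertex P, true.
  by case: s s0 {uniq_s mem_s edgesE size_s} => // v0; exists v0.
pose edge i := [set nth v0 s i; nth v0 s i.+1].
(* the value r0 at sets that are not edges keeps every colour in R *)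
pose colour (E : {set dp_vertex P}) : F :=
  if insub E is Some E' then sval (dp_dist (E' : {E | E \in dp_edges P})) else r0.
have colourR E : colour E \in R.
  by rewrite /colour; case: insubP => [E' _ _|_] //; exact: (svalP (dp_dist E')).
have [p [size_p uniq_p pS okp]] := hpath (fun i => colour (edge i)) (fun i => colourR _).
have ltv v : (index v s < size (rev p))%N.
  by rewrite size_rev size_p -size_s index_mem.
exists (fun v => nth 0 (rev p) (index v s)); split.
- move=> u v /eqP; rewrite nth_uniq ?rev_uniq // => /eqP h.
  by rewrite -(nth_index v0 (mem_s u)) h nth_index.
- by move=> v; apply: pS; rewrite -mem_rev mem_nth.
move=> u v uv.
have colourE : sval (dp_dist (exist _ [set u; v] uv)) = colour [set u; v].
  by rewrite /colour insubT.
rewrite colourE; move: (uv); rewrite {1}edgesE => /imsetP[ab ab_s uvE].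
have [i lti abE] := mem_zip_behead v0 ab_s.
have ltip : (i.+1 < size p)%N by rewrite size_p -size_s.
have /eqP := coloured_stack_nth 0 okp ltip.
rewrite /edge; rewrite abE /= in uvE; rewrite uvE => <-.
have lti0 := ltnW lti.
case: (set2_inj uvE) => -[-> ->]; rewrite !index_uniq //.
by rewrite -sqnormN opprB.
Qed.

Lemma size_bound_of_real (K : realType) (s L t q d k : nat) :
    L%:R <= s%:R - 4 * t%:R `^ (1 / 2) * q%:R `^ ((d%:R + 1) / 2) :> K ->
    (k * k <= t * (4 * q ^ d.+1))%N -> (L + 2 * k <= s)%N.
Proof.
rewrite -mulrA; set y := _ `^ _ * _ => hL hk.
have y0 : 0 <= y by rewrite mulr_ge0 // powR_ge0.
have y2 : y ^+ 2 = t%:R * q%:R ^+ d.+1.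
  rewrite exprMn -!powR_mulrn ?powR_ge0 // -!powRrM.
  rewrite !divfK ?pnatr_eq0 // powRr1 //.
  by rewrite -[_ + 1](natrD _ d 1) addn1 powR_mulrn.
have : k%:R <= 2 * y.
  rewrite -(@ler_pXn2r _ 2) ?nnegrE ?(mulr_ge0 _ y0) // exprMn y2.
  rewrite -!natrX -!natrM ler_nat -mulnn (leq_trans hk) //.
  by rewrite mulnCA.
move=> hk'; rewrite -(ler_nat K) natrD natrM.
have -> : 2%:R * k%:R = 2 * k%:R :> K by [].
by move: hL hk'; lra.
Qed.

Theorem corollary11 (K : realType) (F : finFieldType) (q d t : nat)
  (hq : #|F| = q) (q_odd : odd q) (hd : (2 <= d)%N)
  (ht : (0 < t < q)%N)
  (R : {set F}) (hR0 : 0 \notin R) (hRt : #|R| = t)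
  (S : {set 'rV[F]_d}) (P : dist_path R)
  (hP : #|dp_vertex P|%:R <=
        #|S|%:R - 4 * t%:R `^ (1 / 2) * q%:R `^ ((d%:R + 1) / 2) :> K) :
  contains_dist_path S P.
Proof.
case/andP: ht => t_gt0 _; rewrite -hq in q_odd hP.
apply: contains_dist_path_of_stack => [|c cR].
  by rewrite -card_gt0 hRt.
apply: (coloured_path_of_holes cR (B := 4 * #|F| ^ d.+1)) => //.
- have [s [s0 _ _ _]] := dp_is_path P.
  by case: s s0 => // v s _; apply/card_gt0P; exists v.
- by move=> r D U rR; apply: sphere_hole_bound => //; apply: contraNneq hR0 => <-.
move=> k; rewrite hRt; exact: size_bound_of_real hP.
Qed.
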